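(* Let $x,y\in X$ satisfy $1<\partial(x,y)<k$ and write $i=\partial(x,y)$. Then $$\widehat{x\cap y}=\frac{[k-i]}{q^{k-i+1}[i-1][n-2k]}\bigl(\widehat{x}+\widehat{y}\bigr)+\frac{-1}{q^{k+i}[n-2k]}\,\overline{B_{xy}}+\frac{-[k-i]}{q^{k}[i-1][n-2k]}\,\overline{C_{xy}},$$ $$\widehat{x+y}=\frac{-[n-k-i]}{q^{k-2i+1}[i-1][n-2k]}\bigl(\widehat{x}+\widehat{y}\bigr)+\frac{1}{q^{k}[n-2k]}\,\overline{B_{xy}}+\frac{[n-k-i]}{q^{k-i}[i-1][n-2k]}\,\overline{C_{xy}}.$$
   Context: Let $\mathbb{F}_q$ be a finite field with $q$ elements, let $n,k$ be integers with $n>2k\geq 6$, and let $V$ be an $n$-dimensional vector space over $\mathbb{F}_q$. For $m\in\mathbb{Z}$ write $[m]=(q^m-1)/(q-1)$. Let $P$ be the set of all subspaces of $V$ and $P_\ell$ the set of $\ell$-dimensional subspaces; put $X=P_k$. The Grassmann graph $\Gamma=J_q(n,k)$ has vertex set $X$, with $x,y\in X$ adjacent iff $\dim(x\cap y)=k-1$; $\partial$ is its path-length distance and $\Gamma(x)$ is the set of neighbours of $x$. Let $E$ be a (real) Euclidean space of dimension $[n]-1$ with inner product $\langle\,,\,\rangle$, and let $P_1\to E$, $s\mapsto\widehat{s}$ be a map such that: $E=\mathrm{Span}\{\widehat{s}\mid s\in P_1\}$; $\|\widehat{s}\|^2=[n]-1$ for $s\in P_1$; $\langle\widehat{s},\widehat{t}\rangle=-1$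 for distinct $s,t\in P_1$; and $\sum_{s\in P_1}\widehat{s}=0$. For $u\in P$ define $\widehat{u}=\sum_{s\in P_1,\,s\subseteq u}\widehat{s}$. For $x,y\in X$ with $i=\partial(x,y)$, $1<i<k$, define $\mathcal{B}_{xy}=\{z\in\Gamma(x)\mid\partial(y,z)=i+1\}$, $\mathcal{C}_{xy}=\{z\in\Gamma(x)\mid\partial(y,z)=i-1\}$, $B_{xy}=\sum_{z\in\mathcal{B}_{xy}}\widehat{z}$, $C_{xy}=\sum_{z\in\mathcal{C}_{xy}}\widehat{z}$, and $$\overline{B_{xy}}=B_{xy}-q^{2i}[k-i][n-k-i]\,\widehat{x},\qquad \overline{C_{xy}}=C_{xy}-q[i][i-2]\,\widehat{x}.$$ *)

(* Defs.v *)
From HB Require Import structures.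
From mathcomp Require Import all_boot all_order all_algebra sesquilinear.
From mathcomp Require Export reals.

Set Implicit Arguments.
Unset Strict Implicit.
Unset Printing Implicit Defensive.

Import GRing.Theory.
Local Open Scope ring_scope.

(* m ranges over int: negative exponents do occur, e.g. k - 2i + 1. *)
Definition qint (R : fieldType) (q : R) (m : int) : R := (q ^ m - 1) / (q - 1).

Definition has_walk (T : finType) (e : rel T) (x y : T) (d : nat) : bool :=
  [exists p : d.-tuple T, path e x p && (last x p == y)].

(* Least length of a walk from x to y; the junk value #|T| marks vertices in
   different components (a shortest walk has length less than #|T|). *)
Definition gdist (T : finType) (e : rel T) (x y : T) : nat :=
  find (has_walk e x y) (iota 0 #|T|).

Section VspaceFinite.
Import VectorInternalTheory.
Variables (F : finFieldType) (V : vectType F).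
HB.instance Definition _ := [Countable of {vspace V} by <:].
HB.instance Definition _ := [Finite of {vspace V} by <:].
End VspaceFinite.

Notation subspace V l := {u : {vspace V} | \dim u == l%N}.

Section Grassmann.

Variables (F : finFieldType) (V : vectType F) (k : nat).
Implicit Types x y z : subspace V k.

Definition grassmann_adj : rel (subspace V k) :=
  fun x y => \dim (val x :&: val y)%VS == (k - 1)%N.

Definition grassmann_dist x y : nat := gdist grassmann_adj x y.

Definition Bset x y : {set subspace V k} :=
  [set z | grassmann_adj x z
         & grassmann_dist y z == (grassmann_dist x y + 1)%N].

Definition Cset x y : {set subspace V k} :=
  [set z | grassmann_adj x z
         & (grassmann_dist y z + 1)%N == grassmann_dist x y].

Variables (R : realType) (E : vectType R) (pt : subspace V 1%N -> E).

Definition hat (u : {vspace V}) : E :=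
  \sum_(s : subspace V 1%N | (val s <= u)%VS) pt s.

Definition Bsum x y : E := \sum_(z in Bset x y) hat (val z).
Definition Csum x y : E := \sum_(z in Cset x y) hat (val z).

Definition Bbar x y : E :=
  let q : R := #|F|%:R in
  let n : int := (\dim {:V})%:Z in
  let i : int := (grassmann_dist x y)%:Z in
  Bsum x y -
    (q ^ (2 * i) * qint q (k%:Z - i) * qint q (n - k%:Z - i)) *: hat (val x).

Definition Cbar x y : E :=
  let q : R := #|F|%:R in
  let i : int := (grassmann_dist x y)%:Z in
  Csum x y - (q * qint q i * qint q (i - 2)) *: hat (val x).

End Grassmann.

(* Main.v *)
Require Import Defs.
From mathcomp Require Import all_boot all_order all_algebra sesquilinear reals.
From mathcomp Require Import finfield zify ring lra.

Set Implicit Arguments.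
Unset Strict Implicit.
Unset Printing Implicit Defensive.

Import Order.TTheory GRing.Theory Num.Theory.
Local Open Scope ring_scope.

(** Write [m] for (q^m - 1)/(q - 1), M for the intersection of x and y, J for
    their sum, i for the distance of x and y, and n for dim V.  The theorem
    follows from two evaluations:

      Bbar = - q^(2i) [n-k-i] hat M - q^i [k-i] hat J,
      Cbar = [i-1] hat J + q^(i-1) (hat x + hat y) + q^i [i-1] hat M.

    Solving this linear system for hat M and hat J gives the two formulas; the
    determinant is nonzero because i > 1 and n > 2k, which makes [i-1] and
    [n-2k] nonzero.

    The distance of x and y is k - dim M (grassmann_distE), so the sets B and C
    are described by the dimensions of the intersections of z with x and with
    y.  Every neighbour z of x is reached in two steps: choose the hyperplane
    h of x in which z meets x, then choose z above h.
    - z lies in C iff h contains M and z lies between h and h + y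
      (closer_neighbourE).  Moreover h |-> h + y maps the hyperplanes of x over
      M bijectively to the hyperplanes of J over y (sum_hyperplanes_add).
    - z lies in B iff h does not contain M and z is not inside J
      (farther_neighbourE).

    So all that is needed is the sum of hat z over an elementary family: the
    subspaces between U and W one dimension above U (sum_hat_covers), or one
    dimension below W (sum_hat_hyperplanes).  In the first family a point of W
    outside U lies in exactly one member, namely U + s; in the second, the
    members through such a point s are the hyperplanes of W over U + s, which
    allows an induction on the codimension.  The sum of pt over all points
    vanishes, so hat of the whole space is 0; this disposes of the term that
    the subspaces above h in V contribute to B. *)

(** * q-integers *)

Lemma qint_nat (R : fieldType) (q : R) (d : nat) :
  qint q d = (q ^+ d - 1) / (q - 1).
Proof. by []. Qed.

Lemma qintD (R : fieldType) (q : R) (m d : nat) :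
  qint q (m + d)%N = qint q m + q ^+ m * qint q d.
Proof. by rewrite !qint_nat exprD; ring. Qed.

Lemma qintS (R : fieldType) (q : R) (d : nat) : q != 1 ->
  qint q d.+1 = qint q d + q ^+ d.
Proof.
move=> q1; rewrite !qint_nat exprS; field.
by rewrite subr_eq0.
Qed.

(** * Points, covers and hyperplanes between two subspaces *)

Section Lattice.
Variables (F : finFieldType) (V : vectType F).
Implicit Types (U W s z : {vspace V}).

Lemma dim_add_point U s : \dim s = 1%N -> ~~ (s <= U)%VS ->
  \dim (U + s) = (\dim U).+1.
Proof.
move=> ds sU; have := dimv_sum_cap U s; rewrite ds addn1.
suff -> : \dim (U :&: s) = 0%N by rewrite addn0.
apply/eqP; apply: contraNT sU => dn0.
have /eqP <- : (U :&: s)%VS == s by rewrite eqEdim capvSr ds lt0n.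
exact: capvSl.
Qed.

Lemma exists_point U W : ~~ (W <= U)%VS ->
  exists2 s, \dim s = 1%N & (s <= W)%VS && ~~ (s <= U)%VS.
Proof.
move=> /subvPn[v vW vU]; exists <[v]>%VS; last by rewrite -!memvE vW.
by rewrite dim_vline; case: eqP vU => // ->; rewrite mem0v.
Qed.

Lemma sum_subspace (M : nmodType) (k : nat) (P : pred {vspace V})
    (f : {vspace V} -> M) :
  \sum_(z : subspace V k | P (val z)) f (val z)
    = \sum_(z : {vspace V} | (\dim z == k) && P z) f z.
Proof.
by rewrite (big_sub_cond _ P f).
Qed.

Definition covers U W z :=
  [&& (U <= z)%VS, (z <= W)%VS & \dim z == (\dim U).+1].
Definition hyperplanes U W h :=
  [&& (U <= h)%VS, (h <= W)%VS & (\dim h).+1 == \dim W].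

(** A point outside U lies in a single cover of U: this is why the coefficient
    of such points in the sum over all covers is 1. *)
Lemma covers_point U W s z :
  \dim s = 1%N -> (U <= W)%VS -> (s <= W)%VS -> ~~ (s <= U)%VS ->
  covers U W z && (s <= z)%VS = (z == U + s)%VS.
Proof.
move=> ds UW sW sU; apply/andP/eqP => [[/and3P[Uz zW /eqP dz] sz]|->].
  by apply/esym/eqP; rewrite eqEdim subv_add Uz sz dim_add_point // dz /=.
by rewrite /covers addvSl addvSr subv_add UW sW dim_add_point /=.
Qed.

(** Requiring a hyperplane to contain s only enlarges the lower bound, which
    is what makes the count of hyperplanes inductive. *)
Lemma hyperplanes_point U W s h :
  hyperplanes U W h && (s <= h)%VS = hyperplanes (U + s) W h.
Proof.
by rewrite /hyperplanes subv_add;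
  do !case: (_ <= _)%VS; rewrite /= ?andbT ?andbF.
Qed.

(** [card_vspace] speaks of a vector space packed over a finite type;
    destructing V lets the finite alias [finvect_type] be that type. *)
Lemma card_members U :
  #|[pred v : finvect_type V | v \in U]| = (#|F| ^ \dim U)%N.
Proof.
case: V U => T c U.
exact: (@card_vspace F (finvect_type (Vector.Pack c)) c U).
Qed.

Lemma card_nonzero U :
  #|[pred v : finvect_type V | (v \in U) && (v != 0)]| = (#|F| ^ \dim U).-1.
Proof.
rewrite -card_members [in RHS](cardD1 0).
have -> : (0 : finvect_type V) \in [pred v : finvect_type V | v \in U].
  exact: mem0v.
by rewrite add1n; apply: eq_card => v; rewrite !inE andbC.
Qed.

(** Each nonzero vector of U spans one point of U, and each point contains
    [#|F|.-1] nonzero vectors. *)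
Lemma card_points U :
  (#|[pred s : subspace V 1 | (val s <= U)%VS]| * #|F|.-1 = (#|F| ^ \dim U).-1)%N.
Proof.
rewrite -card_nonzero -[RHS]sum1_card.
transitivity (\sum_(v : finvect_type V | ((v : V) \in U) && ((v : V) != 0%R))
    \sum_(s : subspace V 1 | (val s <= U)%VS && ((v : V) \in val s)) 1)%N; last first.
  apply: eq_big => [v|v /andP[vU v0]]; first by rewrite inE.
  have dv : \dim <[v : V]>%VS == 1%N by rewrite dim_vline v0.
  rewrite (big_pred1 (Sub <[v : V]>%VS dv : subspace V 1)) // => s.
  have lE : (<[v : V]>%VS == val s) = ((v : V) \in val s).
    by rewrite eqEdim (eqP (valP s)) dim_vline v0 andbT -memvE.
  rewrite /= -val_eqE /= [RHS]eq_sym lE.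
  case vs: (_ \in _); rewrite ?andbF // andbT.
  by move: vs; rewrite -lE => /eqP <-; rewrite -memvE.
rewrite (exchange_big_dep (fun s : subspace V 1 => (val s <= U)%VS)) /=;
  last by move=> ? ? _ /andP[].
rewrite -sum_nat_const; apply: eq_bigr => s; rewrite inE /= => sU.
have /= <- : (#|F| ^ \dim (val s)).-1 = #|F|.-1 by rewrite (eqP (valP s)) expn1.
rewrite -card_nonzero -sum1_card; apply: eq_bigl => v.
rewrite !inE sU /=; case vs: ((v : V) \in val s); rewrite ?andbF //= andbT.
by rewrite (subvP sU _ vs).
Qed.

End Lattice.

(** * Sums of hat over covers and hyperplanes *)

Section Hat.
Variables (F : finFieldType) (V : vectType F) (R : realType).
Let q : R := #|F|%:R.
Implicit Types (U W z : {vspace V}).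

Lemma q_gt1 : 1 < q.
Proof. by rewrite ltr1n finNzRing_gt1. Qed.

Lemma q_neq1 : q != 1.
Proof. by rewrite gt_eqF // q_gt1. Qed.

Lemma q_gt0 : 0 < q.
Proof. exact: lt_trans q_gt1. Qed.

(** Taking every pt s equal to 1 turns hat into the number of points.  The
    identities for arbitrary pt below thus contain their own counting lemmas. *)
Lemma hat_one U : hat (fun _ : subspace V 1 => (1 : R^o)) U = qint q (\dim U).
Proof.
rewrite /hat sumr_const qint_nat; apply: (mulIf (x := q - 1)).
  by rewrite subr_eq0 q_neq1.
rewrite mulfVK ?subr_eq0 ?q_neq1 // /q -natrX.
have F0 : (0 < #|F|)%N := ltnW (finNzRing_gt1 F).
have predE m : (0 < m)%N -> m%:R - 1 = m.-1%:R :> R.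
  by case: m => // m _; rewrite -natr1 addrK.
by rewrite !predE ?expn_gt0 ?F0 // -card_points natrM.
Qed.

Section E.
Variables (E : vectType R) (pt : subspace V 1%N -> E).
Local Notation hat := (hat pt).

Lemma hat_split U W : (U <= W)%VS ->
  hat W = hat U + \sum_(s : subspace V 1 | (val s <= W)%VS && ~~ (val s <= U)%VS) pt s.
Proof.
move=> UW; rewrite /Defs.hat (bigID (fun s : subspace V 1 => (val s <= U)%VS)) /=.
congr (_ + _); apply: eq_bigl => s.
by case sU: (_ <= U)%VS; rewrite ?andbF ?(subv_trans sU UW).
Qed.

(** Double counting of the pairs (s, z) with s a point of z: a point of U
    occurs in every member of the family, so only the points of W outside U
    have coefficients that depend on the family. *)
Lemma sum_hat_above (P : pred {vspace V}) U W :
  (forall z, P z -> (U <= z)%VS && (z <= W)%VS) ->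
  \sum_(z | P z) hat z = #|P|%:R *: hat U +
    \sum_(s : subspace V 1 | (val s <= W)%VS && ~~ (val s <= U)%VS)
       #|[pred z | P z && (val s <= z)%VS]|%:R *: pt s.
Proof.
move=> PUW.
under eq_bigr => z /PUW /andP[Uz _] do rewrite (hat_split Uz).
rewrite big_split /= sumr_const scaler_nat; congr (_ + _).
rewrite (exchange_big_dep
  (fun s : subspace V 1 => (val s <= W)%VS && ~~ (val s <= U)%VS)) /=.
  apply: eq_bigr => s /andP[sW sU].
  rewrite scaler_nat -sumr_const; apply: eq_bigl => z.
  by rewrite sU andbT.
by move=> z s /PUW /andP[_ zW] /andP[sz ->]; rewrite (subv_trans sz).
Qed.

Lemma sum_hat_covers U W : (U <= W)%VS ->
  \sum_(z | covers U W z) hat z = hat W + (#|covers U W|%:R - 1) *: hat U.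
Proof.
move=> UW; rewrite (@sum_hat_above _ U W) => [|z /and3P[-> ->] //].
rewrite (hat_split UW) scalerBl scale1r addrACA [RHS]addrC addrA subrK addrC.
congr (_ + _); apply: eq_bigr => s /andP[sW sU].
rewrite (eq_card (B := pred1 (U + val s)%VS)) ?card1 ?scale1r // => z.
by rewrite !inE -(covers_point z (eqP (valP s)) UW sW sU).
Qed.

Lemma sum_hat_hyperplanes_of_count U W (c : R) : (U <= W)%VS ->
  (forall s, \dim s = 1%N -> (s <= W)%VS -> ~~ (s <= U)%VS ->
     #|hyperplanes (U + s) W|%:R = c) ->
  \sum_(h | hyperplanes U W h) hat h =
    #|hyperplanes U W|%:R *: hat U + c *: (hat W - hat U).
Proof.
move=> UW cE; rewrite (@sum_hat_above _ U W) => [|h /and3P[-> ->] //].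
rewrite (hat_split UW) [hat U + _]addrC addrK [c *: _]scaler_sumr.
congr (_ + _); apply: eq_bigr => s /andP[sW sU].
rewrite -(cE (val s)) ?(eqP (valP s)) //; congr (_%:R *: _).
by apply: eq_card => h; rewrite inE hyperplanes_point.
Qed.

End E.

(** With pt constantly 1, [sum_hat_covers] reads
    N [m + 1] = [m + d] + (N - 1) [m] for m = dim U, which determines N. *)
Lemma card_covers U W d : (U <= W)%VS -> \dim W = (\dim U + d)%N ->
  #|covers U W|%:R = qint q d.
Proof.
move=> UW dW; have := sum_hat_covers (fun _ : subspace V 1 => (1 : R^o)) UW.
rewrite !hat_one (eq_bigr (fun _ => qint q (\dim U).+1 : R^o)); last first.
  by move=> z /and3P[_ _ /eqP dz]; rewrite hat_one dz.
rewrite sumr_const dW qintD qintS ?q_neq1 // -[in LHS]mulr_natl /GRing.scale /=.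
set N := #|_|%:R => e.
have : q ^+ \dim U * N = q ^+ \dim U * qint q d by lra.
by apply: mulfI; rewrite expf_neq0 // gt_eqF // q_gt0.
Qed.

(** Induction on the codimension d of U in W.  By induction the coefficient of
    every point outside U is [d - 1], so with pt constantly 1
    [sum_hat_hyperplanes_of_count] reads
    N [m + d - 1] = N [m] + [d - 1] ([m + d] - [m]) for m = dim U.  It
    determines N as soon as [d - 1] is nonzero, hence codimension 1 is treated
    apart: there U itself is the only hyperplane. *)
Lemma card_hyperplanes U W d : (U <= W)%VS -> \dim W = (\dim U + d)%N ->
  #|hyperplanes U W|%:R = qint q d.
Proof.
elim: d U => [|d IHd] U UW dW.
  rewrite (eq_card0 (A := hyperplanes U W)) => [|h].
    by rewrite qint_nat subrr mul0r.
  apply/negP => /and3P[/dimvS Uh _ /eqP dh]; lia.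
have dUs s : \dim s = 1%N -> ~~ (s <= U)%VS -> \dim W = (\dim (U + s)%VS + d)%N.
  by move=> ds sU; rewrite dim_add_point // dW addnS addSn.
have sumE := sum_hat_hyperplanes_of_count (fun _ : subspace V 1 => (1 : R^o)) UW
  (fun s ds sW sU => IHd (U + s)%VS (etrans (subv_add _ _ _) (introT andP (conj UW sW)))
                         (dUs s ds sU)).
case: d {IHd dUs} dW sumE => [dW _ | d dW].
  have -> : qint q 1%N = 1 by rewrite qint_nat expr1 divff // subr_eq0 q_neq1.
  rewrite (eq_card (B := pred1 U)) ?card1 // => h; rewrite !inE.
  apply/and3P/eqP => [[Uh _ /eqP dh]| ->].
    by apply/eqP; rewrite eq_sym eqEdim Uh; lia.
  by rewrite subvv UW dW addn1.
rewrite (eq_bigr (fun _ => qint q (\dim U + d.+1)%N : R^o)); last first.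
  by move=> h /and3P[_ _ /eqP dh]; rewrite hat_one; congr (qint _ _%:Z); lia.
rewrite !hat_one sumr_const -[in LHS]mulr_natl /GRing.scale /=.
set N := #|hyperplanes U W|%:R; rewrite -/N dW !qintD => e.
have : q ^+ \dim U * qint q d.+1 * N
     = q ^+ \dim U * qint q d.+1 * qint q d.+2 by lra.
apply: mulfI; rewrite mulf_neq0 ?expf_neq0 ?gt_eqF ?q_gt0 //.
by rewrite qint_nat divr_gt0 // subr_gt0 ?exprn_egt1 ?q_gt1.
Qed.

Lemma sum_hat_hyperplanes (E : vectType R) (pt : subspace V 1%N -> E) U W d :
  (U <= W)%VS -> \dim W = (\dim U + d.+1)%N ->
  \sum_(h | hyperplanes U W h) hat pt h =
      qint q d.+1 *: hat pt U + qint q d *: (hat pt W - hat pt U).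
Proof.
move=> UW dW; rewrite -(card_hyperplanes UW dW).
apply: sum_hat_hyperplanes_of_count => // s ds sW sU.
apply: card_hyperplanes; first by rewrite subv_add UW.
by rewrite dim_add_point // dW addnS addSn.
Qed.

End Hat.

(** * Distance in the Grassmann graph *)

(** A walk can be shortened to a simple path, whose length is below [#|T|] and
    thus within the range that [gdist] searches. *)
Lemma gdist_leq (T : finType) (e : rel T) x p :
  path e x p -> (gdist e x (last x p) <= size p)%N.
Proof.
move=> /shortenP[p' ep' up' sub]; rewrite leqNgt; apply/negP => lt_p.
have szp' : (size p' <= size p)%N by apply: uniq_leq_size sub; case/andP: up'.
have szT : (size p' < #|T|)%N.
  by rewrite -[(size p').+1]/(size (x :: p')) -(card_uniqP up') max_card.
have lt_p' := leq_ltn_trans szp' lt_p.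
have := before_find 0%N lt_p'; rewrite nth_iota // add0n => /negbT/negP; apply.
by apply/existsP; exists (in_tuple p'); rewrite /= ep' eqxx.
Qed.

Lemma gdist_walk (T : finType) (e : rel T) x p :
  path e x p -> exists p', [/\ path e x p', last x p' = last x p &
    size p' = gdist e x (last x p)].
Proof.
move=> ep; suff : has (has_walk e x (last x p)) (iota 0 #|T|).
  move=> hasw; have /existsP[t /andP[et /eqP lt]] := nth_find 0%N hasw.
  move: t et lt; rewrite nth_iota;
    last by rewrite -[X in (_ < X)%N](size_iota 0) -has_find.
  by move=> t et lt; exists t; rewrite size_tuple.
case/shortenP: ep => p' ep' up' _; apply/hasP; exists (size p').
  by rewrite mem_iota add0n -[(size p').+1]/(size (x :: p')) -(card_uniqP up') max_card.
by apply/existsP; exists (in_tuple p'); rewrite /= ep' eqxx.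
Qed.

Section Distance.
Variables (F : finFieldType) (V : vectType F).
Implicit Types (U W s z : {vspace V}).

(** For a point s of W outside U, U plus a complement of U + s in W is a
    hyperplane of W. *)
Lemma exists_hyperplane U W : (U <= W)%VS -> U != W -> exists h, hyperplanes U W h.
Proof.
move=> UW neq; have /exists_point[s ds /andP[sW sU]] : ~~ (W <= U)%VS.
  by apply: contra neq => WU; rewrite eqEsubv UW.
have dUs := dim_add_point ds sU.
exists (U + (W :\: (U + s)))%VS; apply/and3P; split.
- exact: addvSl.
- by rewrite subv_add UW diffvSl.
have := dimv_cap_compl W (U + s).
have -> : (W :&: (U + s))%VS = (U + s)%VS by apply/capv_idPr; rewrite subv_add UW.
suff : \dim (U + (W :\: (U + s))) = (\dim U + \dim (W :\: (U + s)))%N by lia.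
apply: dimv_disjoint_sum; apply/eqP; rewrite -subv0 -(capv_diff W (U + s)) capvC.
by apply: capvS => //; apply: addvSl.
Qed.

Variable k : nat.
Implicit Types x y : subspace V k.

(** One step of a walk lowers the dimension of the intersection with a fixed
    space by at most 1, so a walk from x to y has at least k - dim (x :&: y)
    steps. *)
Lemma grassmann_path x p : path (@grassmann_adj F V k) x p ->
  (k <= \dim (val x :&: val (last x p)) + size p)%N.
Proof.
elim: p x => [|z p IHp] x.
  by rewrite /= capvv (eqP (valP x)) addn0.
rewrite [path _ _ _]/= [last _ _]/= [size _]/= => /andP[/eqP adj /IHp].
set y := last z p.
have h := dimv_sum_cap (val z :&: val x) (val z :&: val y).
have dz := eqP (valP z).
have h1 : (\dim (val z :&: val x + val z :&: val y) <= \dim (val z))%N.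
  by apply: dimvS; rewrite subv_add !capvSl.
have h2 : (\dim ((val z :&: val x) :&: (val z :&: val y)) <= \dim (val x :&: val y))%N.
  by apply: dimvS; apply: capvS; apply: capvSr.
have h3 := capvC (val x) (val z).
rewrite -h3 in h h1 h2.
lia.
Qed.

(** Exchange: keep a hyperplane of x over x :&: y and add to it a point of y
    outside x. *)
Lemma grassmann_step x y : (\dim (val x :&: val y) < k)%N ->
  exists2 z, grassmann_adj x z & (\dim (val x :&: val y) < \dim (val z :&: val y))%N.
Proof.
move=> lt; have dx := eqP (valP x); have dy := eqP (valP y).
have [h /and3P[Mh hx /eqP dh]] : exists h, hyperplanes (val x :&: val y) (val x) h.
  by apply: exists_hyperplane; [exact: capvSl | apply: contraTneq lt => ->; lia].
have [s ds /andP[sy sx]] :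
    exists2 s, \dim s = 1%N & (s <= val y)%VS && ~~ (s <= val x)%VS.
  by apply: exists_point; apply: contraTN lt => /capv_idPr ->; lia.
have sh : ~~ (s <= h)%VS by apply: contra sx => /subv_trans; apply.
have dz : \dim (h + s) == k by rewrite dim_add_point // dh dx.
rewrite dx in dh.
exists (Sub (h + s)%VS dz); rewrite /grassmann_adj SubK.
  have : (h <= val x :&: (h + s))%VS by rewrite subv_cap hx addvSl.
  move/dimvS; have := ltn_leqif (dimv_leqif_sup (capvSr (val x) (h + s))).
  have -> : ~~ (h + s <= val x :&: (h + s))%VS.
    by rewrite subv_cap subv_add (negbTE sx) andbF.
  by rewrite (eqP dz); lia.
have <- : \dim ((val x :&: val y) + s) = (\dim (val x :&: val y)).+1.
  by rewrite dim_add_point //; apply: contra sx => /subv_trans; apply; apply: capvSl.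
by apply: dimvS; rewrite subv_cap addvS //= subv_add capvSr.
Qed.

Lemma grassmann_walk x y : exists p, [/\ path (@grassmann_adj F V k) x p, last x p = y &
  (\dim (val x :&: val y) + size p <= k)%N].
Proof.
have [d] := ubnP (k - \dim (val x :&: val y)); elim: d x => // d IHd x le.
have dx := eqP (valP x); have dy := eqP (valP y).
have := dimvS (capvSl (val x) (val y)); rewrite dx leq_eqVlt => /predU1P[eqk|lt].
  exists [::]; split=> //=; last by rewrite addn0 eqk.
  apply: val_inj; apply/eqP; rewrite eqEdim dx dy leqnn andbT.
  by apply/capv_idPl/eqP; rewrite eqEdim capvSl dx eqk leqnn.
have [z xz ltz] := grassmann_step lt.
have [|p [zp lz szp]] := IHd z; first lia.
exists (z :: p); split; [by rewrite /= xz zp | by [] | rewrite [size _]/=; lia].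
Qed.

Lemma grassmann_distE x y : (grassmann_dist x y + \dim (val x :&: val y))%N = k.
Proof.
have [p [xp lp szp]] := grassmann_walk x y.
have := gdist_leq xp; have [p' [xp' lp' szp']] := gdist_walk xp.
have := grassmann_path xp'; rewrite lp' szp' lp => kle le; apply/eqP.
by rewrite eqn_leq addnC kle andbT; apply: leq_trans szp; rewrite leq_add2l.
Qed.

End Distance.

(** * Neighbours of X that are closer to Y or farther from Y *)

Section Neighbours.
Variables (F : finFieldType) (V : vectType F).
Implicit Types (X Y h z t : {vspace V}).

Lemma hyperplane_cap_eq X Y h : (X :&: Y <= h)%VS -> (h <= X)%VS -> (h :&: Y = X :&: Y)%VS.
Proof.
move=> Mh hX; apply/eqP; rewrite eqEsubv capvS //=.
by rewrite subv_cap Mh capvSr.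
Qed.

Lemma hyperplane_add_cap X Y h : (X :&: Y <= h)%VS -> (h <= X)%VS -> (X :&: (h + Y) = h)%VS.
Proof.
move=> Mh hX; rewrite capvC -vspace_modl // capvC.
by apply/addv_idPl.
Qed.

(** X :&: z and Y :&: z live inside z, whose dimension forces their
    intersection to be as large as X :&: Y, hence equal to it. *)
Lemma closer_neighbour X Y z : \dim X = \dim Y -> 
  \dim z = \dim X -> (\dim (X :&: z)).+1 = \dim X ->
  \dim (Y :&: z) = (\dim (X :&: Y)).+1 ->
  hyperplanes (X :&: Y) X (X :&: z).
Proof.
move=> dXY dz dXz dYz; rewrite /hyperplanes capvSl dXz eqxx !andbT.
have sumle : (\dim (X :&: z + Y :&: z) <= \dim z)%N.
  by apply: dimvS; rewrite subv_add !capvSr.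
have := dimv_sum_cap (X :&: z) (Y :&: z).
have capM : ((X :&: z) :&: (Y :&: z) <= X :&: Y)%VS by apply: capvS; apply: capvSl.
have := dimvS capM => capMd dims.
have /eqP <- : ((X :&: z) :&: (Y :&: z) == X :&: Y)%VS by rewrite eqEdim capM; lia.
exact: capvSl.
Qed.

(** For z closer to Y, a dimension count gives z = h + (Y :&: z).  Conversely a
    cover z of h inside h + Y satisfies the same equation by modularity, and
    it meets X in h only because X :&: (h + Y) = h. *)
Lemma closer_neighbourE X Y h z : \dim X = \dim Y -> hyperplanes (X :&: Y) X h ->
  [&& \dim z == \dim X, (\dim (X :&: z)).+1 == \dim X,
      \dim (Y :&: z) == (\dim (X :&: Y)).+1 & (X :&: z == h)%VS]
  = covers h (h + Y) z.
Proof.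
move=> dXY /and3P[Mh hX /eqP dh]; apply/and4P/and3P.
  move=> [/eqP dz /eqP dXz /eqP dYz /eqP hE]; split; last by rewrite -hE dz dXz.
    by rewrite -hE capvSr.
  have hz : (h + (Y :&: z) <= z)%VS by rewrite subv_add -hE !capvSr.
  have : (z <= h + (Y :&: z))%VS.
    have := dimv_sum_cap h (Y :&: z).
    have := dimvS (capvS hX (capvSl Y z)).
    rewrite -(geq_leqif (dimv_leqif_sup hz)). lia.
  by move/subv_trans; apply; apply: addvS => //; apply: capvSl.
move=> [hz zhY /eqP dz].
have XzE : (X :&: z)%VS = h.
  apply/eqP; rewrite eqEsubv subv_cap hX hz !andbT.
  by rewrite -[X in (_ <= X)%VS](hyperplane_add_cap Mh hX) capvS.
rewrite XzE eqxx dh dz dh eqxx; split=> //.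
have zE : (h + (Y :&: z))%VS = z by rewrite vspace_modl //; apply/capv_idPr.
have := dimv_sum_cap h (Y :&: z); rewrite zE.
have -> : (h :&: (Y :&: z))%VS = (X :&: Y)%VS.
  by rewrite capvA (hyperplane_cap_eq Mh hX); apply/capv_idPl/(subv_trans Mh).
lia.
Qed.

(** If X :&: z contained X :&: Y, so would Y :&: z, which is too small. *)
Lemma farther_neighbour X Y z : (\dim (X :&: z)).+1 = \dim X ->
  (\dim (Y :&: z)).+1 = \dim (X :&: Y) ->
  hyperplanes 0 X (X :&: z) && ~~ (X :&: Y <= X :&: z)%VS.
Proof.
move=> dXz dYz; rewrite /hyperplanes sub0v capvSl dXz eqxx /=.
apply/negP => Mz; have : (X :&: Y <= Y :&: z)%VS.
  by rewrite subv_cap capvSr (subv_trans Mz) // capvSr.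
by move/dimvS; lia.
Qed.

(** Since h does not contain X :&: Y, the two together span X; hence
    h + Y = X + Y, and a cover z of h has a smaller intersection with Y exactly
    when it is not inside X + Y, by comparing z + Y with X + Y. *)
Lemma farther_neighbourE X Y h z :
  \dim X = \dim Y -> hyperplanes 0 X h -> ~~ (X :&: Y <= h)%VS ->
  [&& \dim z == \dim X, (\dim (X :&: z)).+1 == \dim X,
      (\dim (Y :&: z)).+1 == \dim (X :&: Y) & (X :&: z == h)%VS]
  = covers h fullv z && ~~ (z <= X + Y)%VS.
Proof.
move=> dXY /and3P[_ hX /eqP dh] Mh; have dJ := dimv_sum_cap X Y.
apply/and4P/andP.
  move=> [/eqP dz /eqP dXz /eqP dYz /eqP hE]; split.
    by rewrite /covers subvf dz -dXz -hE capvSr eqxx.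
  apply/negP => zJ; have : (z + Y <= X + Y)%VS by rewrite subv_add zJ addvSr.
  move/dimvS; have := dimv_sum_cap z Y; rewrite (capvC z); lia.
move=> [/and3P[hz _ /eqP dz] zJ].
have hXz : (h <= X :&: z)%VS by rewrite subv_cap hX.
have zX : ~~ (z <= X)%VS by apply: contra zJ => /subv_trans; apply; apply: addvSl.
have dXz : (\dim (X :&: z)).+1 = \dim X.
  have := ltn_leqif (dimv_leqif_sup (capvSr X z)).
  rewrite subv_cap subvv andbT zX; have := dimvS hXz; lia.
have XzE : (X :&: z == h)%VS by rewrite eq_sym eqEdim hXz; lia.
rewrite dz dh dXz !eqxx XzE; split=> //; apply/eqP.
have hMX : (h + X :&: Y <= X)%VS by rewrite subv_add hX capvSl.
have dhM : \dim (h + X :&: Y) = \dim X.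
  have := ltn_leqif (dimv_leqif_sup (addvSl h (X :&: Y))).
  by rewrite subv_add subvv Mh; have := dimvS hMX; lia.
have hMXE : (h + X :&: Y)%VS = X by apply/eqP; rewrite eqEdim hMX dhM leqnn.
have Yhz : (h :&: (X :&: Y) <= Y :&: z)%VS.
  by rewrite subv_cap (subv_trans (capvSr _ _) (capvSr _ _)) (subv_trans (capvSl _ _) hz).
have JzY : (X + Y <= z + Y)%VS.
  rewrite subv_add addvSr andbT -hMXE addvS //; exact: capvSr.
have := ltn_leqif (dimv_leqif_sup JzY).
rewrite subv_add addvSr andbT zJ.
have := dimvS Yhz; have := dimv_sum_cap h (X :&: Y); have := dimv_sum_cap z Y.
rewrite (capvC z); lia.
Qed.

(** The maps h |-> h + Y and t |-> X :&: t are mutually inverse bijections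
    between the intervals from X :&: Y to X and from Y to X + Y (the diamond
    isomorphism of a modular lattice), and they preserve codimension. *)
Lemma hyperplane_addE X Y h :
  hyperplanes Y (X + Y) (h + Y) && (X :&: (h + Y) == h)%VS = hyperplanes (X :&: Y) X h.
Proof.
apply/andP/idP => [[/and3P[_ _ /eqP d] /eqP hE]|/and3P[Mh hX /eqP dh]].
  have hX : (h <= X)%VS by rewrite -hE capvSl.
  have Mh : (X :&: Y <= h)%VS by rewrite -hE capvS // addvSr.
  apply/and3P; split=> //.
  have := dimv_sum_cap h Y; rewrite (hyperplane_cap_eq Mh hX).
  have := dimv_sum_cap X Y; lia.
rewrite hyperplane_add_cap // eqxx; split=> //; apply/and3P; split; first exact: addvSr.
  by rewrite addvS.
have := dimv_sum_cap h Y; rewrite (hyperplane_cap_eq Mh hX).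
have := dimv_sum_cap X Y; lia.
Qed.

Lemma sum_hyperplanes_add (M : nmodType) (f : {vspace V} -> M) X Y :
  \sum_(h | hyperplanes (X :&: Y) X h) f (h + Y)%VS
    = \sum_(t | hyperplanes Y (X + Y) t) f t.
Proof.
rewrite [RHS](reindex_onto (fun h => h + Y)%VS (fun t => X :&: t)%VS) /=.
  by apply: eq_bigl => h; rewrite hyperplane_addE.
move=> t /and3P[Yt tJ _]; by rewrite addvC vspace_modl // addvC; apply/capv_idPr.
Qed.

End Neighbours.

(** * The sums over B and C *)

Section Sums.
Variables (F : finFieldType) (V : vectType F) (k : nat).
Variables (R : realType) (E : vectType R) (pt : subspace V 1%N -> E).
Variables (x y : subspace V k).
Let q : R := #|F|%:R.
Local Notation hat := (hat pt).
Local Notation X := (val x).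
Local Notation Y := (val y).
Let dX : \dim X = k := eqP (valP x).
Let dY : \dim Y = k := eqP (valP y).

(** Here the distance is d + 1.  Each hyperplane h contributes
    hat (h + Y) + ([d + 1] - 1) hat h; then the sum over h is taken once in the
    interval from Y to X + Y and once in the interval from X :&: Y to X. *)
Lemma CsumE d : grassmann_dist x y = d.+1 ->
  Csum pt x y = qint q d.+1 *: hat Y + qint q d *: (hat (X + Y) - hat Y)
    + (qint q d.+1 - 1) *:
      (qint q d.+1 *: hat (X :&: Y) + qint q d *: (hat X - hat (X :&: Y))).
Proof.
move=> dist; have distM := grassmann_distE x y; rewrite dist in distM.
have dJ := dimv_sum_cap X Y; rewrite dX dY in dJ.
pose P (z : {vspace V}) :=
  ((\dim (X :&: z)).+1 == \dim X) && (\dim (Y :&: z) == (\dim (X :&: Y)).+1).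
transitivity (\sum_(z : subspace V k | P (val z)) hat (val z)).
  apply: eq_bigl => z; rewrite inE /P /grassmann_adj dist.
  have := grassmann_distE y z; have := dimvS (capvSl Y (val z)).
  move: dX dY; clear -distM; lia.
rewrite sum_subspace (partition_big (fun z => X :&: z)%VS (hyperplanes (X :&: Y) X));
  last first.
  move=> z /andP[/eqP dz /andP[/eqP dXz /eqP dYz]].
  apply: closer_neighbour => //; congruence.
transitivity (\sum_(h | hyperplanes (X :&: Y) X h)
    (hat (h + Y) + (qint q d.+1 - 1) *: hat h)).
  apply: eq_bigr => h lh; have /and3P[Mh hX /eqP dh] := lh.
  rewrite -(@card_covers _ V R h (h + Y) d.+1) ?addvSl //; last first.
    have := dimv_sum_cap h Y; rewrite (hyperplane_cap_eq Mh hX); lia.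
  rewrite -sum_hat_covers ?addvSl //; apply: eq_bigl => z.
  rewrite -(closer_neighbourE z _ lh) ?dX ?dY // /P dX -!andbA //.
rewrite big_split /= -scaler_sumr (sum_hyperplanes_add hat).
rewrite (@sum_hat_hyperplanes _ _ _ _ pt Y (X + Y) d) ?addvSr //; last lia.
by rewrite (@sum_hat_hyperplanes _ _ _ _ pt (X :&: Y) X d) ?capvSl // dX; lia.
Qed.

Hypothesis pt_sum : \sum_(s : subspace V 1) pt s = 0.

Lemma hat0 : hat 0%VS = 0.
Proof.
rewrite /Defs.hat big_pred0 // => s; apply/negP => /dimvS.
by rewrite (eqP (valP s)) dimv0.
Qed.

Lemma hat_full : hat fullv = 0.
Proof. by rewrite -[RHS]pt_sum; apply: eq_bigl => s; rewrite subvf. Qed.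

(** Each hyperplane h of X not over X :&: Y contributes its covers in V minus
    those in X + Y.  The sum over these h is the sum over all hyperplanes of X
    minus the sum over those above X :&: Y. *)
Lemma BsumE d j n : grassmann_dist x y = d.+1 -> k = j.+1 ->
  \dim {:V} = (j + n)%N ->
  Bsum pt x y = - (qint q k - qint q d.+1) *: hat (X + Y)
    + (qint q n - qint q d.+2) *:
      (qint q j *: hat X
       - (qint q d.+1 *: hat (X :&: Y) + qint q d *: (hat X - hat (X :&: Y)))).
Proof.
move=> dist kj dV; have distM := grassmann_distE x y; rewrite dist in distM.
have dJ := dimv_sum_cap X Y; rewrite dX dY in dJ.
pose P (z : {vspace V}) :=
  ((\dim (X :&: z)).+1 == \dim X) && ((\dim (Y :&: z)).+1 == \dim (X :&: Y)).
pose Q h := hyperplanes 0 X h && ~~ (X :&: Y <= h)%VS.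
have sumQ (f : {vspace V} -> E) : \sum_(h | Q h) f h =
    \sum_(h | hyperplanes 0 X h) f h - \sum_(h | hyperplanes (X :&: Y) X h) f h.
  apply/esym/eqP; rewrite subr_eq addrC (bigID (fun h => X :&: Y <= h)%VS) /=.
  by apply/eqP; congr (_ + _); apply: eq_bigl => h; rewrite hyperplanes_point add0v.
transitivity (\sum_(z : subspace V k | P (val z)) hat (val z)).
  apply: eq_bigl => z; rewrite inE /P /grassmann_adj dist.
  have := grassmann_distE y z; have := dimvS (capvSl Y (val z)).
  move: dX dY kj; clear -distM; lia.
rewrite sum_subspace (partition_big (fun z => X :&: z)%VS Q); last first.
  by move=> z /andP[/eqP dz /andP[/eqP dXz /eqP dYz]]; apply: farther_neighbour.
transitivity (\sum_(h | Q h) (- hat (X + Y) + (qint q n - qint q d.+2) *: hat h)).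
  apply: eq_bigr => h /andP[lh Mh]; have /and3P[_ hX /eqP dh] := lh.
  have hJ : (h <= X + Y)%VS := subv_trans hX (addvSl _ _).
  transitivity (\sum_(z | covers h fullv z && ~~ (z <= X + Y)%VS) hat z).
    apply: eq_bigl => z; rewrite -(farther_neighbourE z _ lh) ?dX ?dY // /P dX -!andbA //.
  (* The codimension of h is n in V and d + 2 in X + Y. *)
  have : \sum_(z | covers h fullv z) hat z =
      \sum_(z | covers h fullv z && (z <= X + Y)%VS) hat z +
      \sum_(z | covers h fullv z && ~~ (z <= X + Y)%VS) hat z.
    by rewrite (bigID (fun z => z <= X + Y)%VS).
  rewrite (sum_hat_covers pt (subvf h)) (@card_covers _ V R _ _ n) ?subvf //;
    last by rewrite dV; lia.
  rewrite hat_full add0r (eq_bigl (covers h (X + Y))) => [|z]; last first.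
    by rewrite /covers subvf; do !case: (_ <= _)%VS; rewrite ?andbT ?andbF.
  rewrite (sum_hat_covers pt hJ) (@card_covers _ V R _ _ d.+2) //; last lia.
  move=> e; apply: (addrI (hat (X + Y) + (qint #|F|%:R d.+2 - 1) *: hat h)).
  rewrite -e addrACA subrr add0r -scalerDl; congr (_ *: _); rewrite /q; ring.
rewrite big_split /= -scaler_sumr !sumQ !sumr_const.
rewrite (@sum_hat_hyperplanes _ _ _ _ pt (X :&: Y) X d) ?capvSl //; last lia.
rewrite (@sum_hat_hyperplanes _ _ _ _ pt 0%VS X j) ?sub0v //; last by rewrite dimv0 dX.
rewrite hat0 scaler0 add0r subr0; congr (_ + _).
rewrite -!scaler_nat -scalerBl.
rewrite (@card_hyperplanes _ V R _ _ k) ?sub0v ?dimv0 //.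
rewrite (@card_hyperplanes _ V R _ _ d.+1) ?capvSl ?dX //; last lia.
by rewrite scalerN scaleNr.
Qed.

End Sums.

(** * Solving for the intersection and the sum *)

(** An identity between linear combinations of fixed vectors becomes a field
    identity under a linear form. *)
Lemma eq_of_scalars (R : fieldType) (E : vectType R) (u v : E) :
  (forall f : {scalar E}, f u = f v) -> u = v.
Proof.
move=> fuv; rewrite (coord_vbasis (memvf u)) (coord_vbasis (memvf v)).
by apply: eq_bigr => i _; congr (_ *: _); apply: fuv.
Qed.

Section Bars.
Variables (F : finFieldType) (V : vectType F) (k : nat).
Variables (R : realType) (E : vectType R) (pt : subspace V 1%N -> E).
Variables (x y : subspace V k).
Let q : R := #|F|%:R.
Local Notation hat := (hat pt).

(** Parametrization used from here on: the distance i is d + 1, k - i = e and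
    n - 2k = m, so that every exponent is a natural number. *)
Lemma BbarE d e m :
  \sum_(s : subspace V 1) pt s = 0 -> grassmann_dist x y = d.+1 ->
  k = (d + e).+1 -> \dim {:V} = (2 * k + m)%N ->
  Bbar pt x y = - (q ^+ (2 * d.+1) * qint q (e + m)%N) *: hat (val x :&: val y)
                - (q ^+ d.+1 * qint q e) *: hat (val x + val y).
Proof.
move=> pt_sum dist kE dimV.
have dV : \dim {:V} = (d + e + (d + e + m).+2)%N by rewrite dimV kE; lia.
rewrite /Bbar /= (BsumE pt_sum dist kE dV) -/q dist dimV.
have -> : k%:Z - d.+1%:Z = e%:Z by lia.
have -> : (2 * k + m)%N%:Z - k%:Z - d.+1%:Z = (e + m)%N%:Z by lia.
have -> : 2 * d.+1%:Z = (2 * d.+1)%N%:Z by lia.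
rewrite -exprnP.
set X := hat (val x); set M := hat (_ :&: _); set J := hat (_ + _).
have q1 : q - 1 != 0 by rewrite subr_eq0 q_neq1.
rewrite !qint_nat kE mulnC !exprM ?exprS !exprD.
apply: eq_of_scalars => f.
rewrite !(linearD, linearB, linearN, scalarZ) /=.
by field.
Qed.

Lemma CbarE d : grassmann_dist x y = d.+1 ->
  Cbar pt x y = qint q d *: hat (val x + val y)
     + q ^+ d *: (hat (val x) + hat (val y))
     + (q ^+ d.+1 * qint q d) *: hat (val x :&: val y).
Proof.
move=> dist; rewrite /Cbar /= (CsumE pt dist) -/q dist.
set X := hat (val x); set Y := hat (val y).
set M := hat (_ :&: _); set J := hat (_ + _).
have q1 : q - 1 != 0 by rewrite subr_eq0 q_neq1.
have q0 : q != 0 by rewrite gt_eqF // q_gt0.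
have -> : qint q (d.+1%:Z - 2) = (q ^+ d / q - 1) / (q - 1).
  rewrite /qint. have -> : d.+1%:Z - 2 = d%:Z - 1 by lia.
  by rewrite expfzDr // exprnP.
rewrite !qint_nat ?exprS.
apply: eq_of_scalars => f.
rewrite !(linearD, linearB, linearN, scalarZ) /=.
by field; rewrite -/q q1.
Qed.

End Bars.

Theorem theorem12p13
  (F : finFieldType) (n k : nat) (hk : (6 <= 2 * k)%N) (hn : (2 * k < n)%N)
  (V : vectType F) (dimV : \dim {:V} = n)
  (R : realType) (E : vectType R) (inner : {dot E for idfun})
  (dimE : (\dim {:E})%:R = qint (#|F|%:R : R) n%:Z - 1)
  (pt : subspace V 1%N -> E)
  (pt_span : (<<[seq pt s | s : subspace V 1%N]>>)%VS = {:E}%VS)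
  (pt_norm : forall s, inner (pt s) (pt s) = qint #|F|%:R n%:Z - 1)
  (pt_inner : forall s t, s != t -> inner (pt s) (pt t) = -1)
  (pt_sum : \sum_(s : subspace V 1%N) pt s = 0)
  (x y : subspace V k)
  (dist_gt1 : (1 < grassmann_dist x y)%N)
  (dist_ltk : (grassmann_dist x y < k)%N) :
  let q : R := #|F|%:R in
  let br : int -> R := qint q in
  let N : int := n%:Z in
  let K : int := k%:Z in
  let i : int := (grassmann_dist x y)%:Z in
  hat pt (val x :&: val y)%VS =
      (br (K - i) / (q ^ (K - i + 1) * br (i - 1) * br (N - 2 * K)))
        *: (hat pt (val x) + hat pt (val y))
    + (-1 / (q ^ (K + i) * br (N - 2 * K))) *: Bbar pt x y
    + (- br (K - i) / (q ^ K * br (i - 1) * br (N - 2 * K))) *: Cbar pt x y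
  /\
  hat pt (val x + val y)%VS =
      (- br (N - K - i) / (q ^ (K - 2 * i + 1) * br (i - 1) * br (N - 2 * K)))
        *: (hat pt (val x) + hat pt (val y))
    + (1 / (q ^ K * br (N - 2 * K))) *: Bbar pt x y
    + (br (N - K - i) / (q ^ (K - i) * br (i - 1) * br (N - 2 * K)))
        *: Cbar pt x y.
Proof.
have [d dist] : exists d, grassmann_dist x y = d.+1.
  by case: (grassmann_dist x y) dist_gt1 => // d; exists d.
rewrite dist in dist_gt1 dist_ltk.
have kE : k = (d + (k - d.+1)).+1 by lia.
have nE : n = (2 * k + (n - 2 * k))%N by lia.
have m_gt0 : (0 < n - 2 * k)%N by lia.
set e := (k - d.+1)%N in kE; set m := (n - 2 * k)%N in nE m_gt0.
have dV : \dim {:V} = (2 * k + m)%N by rewrite dimV.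
move=> q br N K i; rewrite /br.
have -> : K - i = e%:Z by rewrite /K /i; lia.
have -> : i - 1 = d%:Z by rewrite /i; lia.
have -> : N - 2 * K = m%:Z by rewrite /N /K; lia.
have -> : N - K - i = (e + m)%N%:Z by rewrite /N /K /i; lia.
have -> : e%:Z + 1 = e.+1%:Z by lia.
have -> : K + i = (d.+1 + e + d.+1)%N%:Z by rewrite /K /i; lia.
have -> : K - 2 * i + 1 = e%:Z - d%:Z by rewrite /K /i; lia.
have -> : K = (d.+1 + e)%N%:Z by rewrite /K; lia.
(* K - 2i + 1 may be negative: q ^ (e - d) is split as q ^+ e / q ^+ d. *)
have q0 : q != 0 by rewrite gt_eqF // q_gt0.
have q1 : q - 1 != 0 by rewrite subr_eq0 q_neq1.
rewrite expfzDr // -invr_expz -!exprnP.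
have pow_neq1 j : (0 < j)%N -> q ^+ j - 1 != 0.
  by move=> j0; rewrite subr_eq0 gt_eqF // exprn_egt1 ?q_gt1 // -lt0n.
have d1 : q ^+ d - 1 != 0 by apply: pow_neq1; lia.
have m1 := pow_neq1 _ m_gt0.
have [a0 b0 c0] : [/\ q ^+ d != 0, q ^+ e != 0 & q ^+ m != 0] by rewrite !expf_neq0.
rewrite (BbarE pt_sum dist kE dV) (CbarE pt dist) -/q.
rewrite !qint_nat mulnC !exprM ?exprS !exprD ?exprS.
set X := hat pt (val x); set Y := hat pt (val y).
set M := hat pt (_ :&: _); set J := hat pt (_ + _).
clearbody X Y M J.
split; apply: eq_of_scalars => f; rewrite !(linearD, linearB, linearN, scalarZ) /=.
- by field; rewrite -/q q0 a0 b0 q1 d1 m1.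
- by field; rewrite -/q q0 a0 b0 q1 d1 m1.
Qed.
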